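(* Let $f:[0,\infty)\to[0,\infty)$ be $2$-radical convex and let $a,b\ge 0$. If $0\le t\le 1$, then $$f\left((1-t)a+tb\right)+f\left(\sqrt{t(1-t)}\,|a-b|\right)\le (1-t)f(a)+tf(b).$$
   Context: Let $p\ge 1$. A continuous function $f:[0,\infty)\to[0,\infty)$ with $f(0)=0$ is called $p$-radical convex if the function $x\mapsto f\left(x^{1/p}\right)$ is convex on $[0,\infty)$. In particular $f$ is $2$-radical convex if $x\mapsto f(\sqrt{x})$ is convex on $[0,\infty)$. *)

(* Defs.v *)
From mathcomp Require Import all_boot all_order all_algebra.
From mathcomp Require Import all_classical all_reals all_analysis.

Set Implicit Arguments.
Unset Strict Implicit.
Unset Printing Implicit Defensive.

Import Order.TTheory GRing.Theory Num.Theory.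
Import numFieldNormedType.Exports.

Local Open Scope classical_set_scope.
Local Open Scope ring_scope.

(* A function [0, oo) -> [0, oo) is encoded as f : R -> R, whose values on the
   negative reals are unconstrained. The notion is meant for 1 <= p; for p != 0
   one has 0 `^ p^-1 = 0, so x `^ p^-1 is the usual p-th root on all of
   [0, oo). *)
Definition radical_convex (R : realType) (p : R) (f : R -> R) : Prop :=
  [/\ {within `[0, +oo[, continuous f},
      (forall x : R, 0 <= x -> 0 <= f x),
      f 0 = 0
    & convex_function (`[0, +oo[%classic : set R)
        (fun x : R => f (x `^ p^-1))].

(* Main.v *)
Require Import Defs.
From mathcomp Require Import all_boot all_order all_algebra.
From mathcomp Require Import all_classical all_reals all_analysis.
From mathcomp Require Import ring.

(** Put g x = f (sqrt x), convex on [0, oo) with g 0 = 0, hence superadditive.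
    Since ((1-t) a + t b)^2 + t (1-t) (a-b)^2 = (1-t) a^2 + t b^2,
    superadditivity bounds the left-hand side by g ((1-t) a^2 + t b^2), and
    convexity bounds this by (1-t) g (a^2) + t g (b^2). *)

Import Order.TTheory GRing.Theory Num.Theory.

Local Open Scope ring_scope.

Lemma convex_function_nonneg_le (R : realType) (g : R -> R)
    (hg : convex_function (`[0, +oo[%classic : set R) g) (x y s : R) :
  0 <= x -> 0 <= y -> 0 <= s -> s <= 1 ->
  g (s * x + (1 - s) * y) <= s * g x + (1 - s) * g y.
Proof.
move=> x0 y0 s0 s1.
have mem (z : R) : 0 <= z -> z \in (`[0, +oo[%classic : set R).
  by move=> z0; rewrite inE /= in_itv /= andbT.
by have := hg (Itv01 s0 s1) x y (mem _ x0) (mem _ y0).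
Qed.

(** As [g 0 <= 0], convexity puts [g] on [[0, x + y]] below the line through the origin and
    [(x + y, g (x + y))]. Adding these bounds at [x] and at [y] gives the claim. *)
Lemma convex_function_superadditive (R : realType) (g : R -> R)
    (hg : convex_function (`[0, +oo[%classic : set R) g) (x y : R) :
  g 0 <= 0 -> 0 <= x -> 0 <= y -> g x + g y <= g (x + y).
Proof.
move=> g0 x0 y0.
(* The weights [u / (x + y)] need a nonzero sum; otherwise [x = y = 0] and only [g 0 <= 0] is left
   to use. *)
have [xy0|xyN0] := eqVneq (x + y) 0.
  have /andP[/eqP -> /eqP ->] : (x == 0) && (y == 0).
    by rewrite -paddr_eq0 // xy0.
  by rewrite addr0 gerDl.
have xy_gt0 : 0 < x + y by rewrite lt_def xyN0 addr_ge0.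
(* u = (u / (x + y)) (x + y) + (1 - u / (x + y)) 0 *)
have chord u : 0 <= u -> u <= x + y -> g u <= u / (x + y) * g (x + y).
  move=> u0 uxy.
  have s0 : 0 <= u / (x + y) by rewrite divr_ge0 // ltW.
  have s1 : u / (x + y) <= 1 by rewrite ler_pdivrMr // mul1r.
  have := @convex_function_nonneg_le R g hg _ 0 _ (ltW xy_gt0) (lexx 0) s0 s1.
  rewrite mulr0 addr0 divfK // => /le_trans; apply.
  by rewrite gerDl mulr_ge0_le0 // subr_ge0.
have -> : g (x + y) = x / (x + y) * g (x + y) + y / (x + y) * g (x + y).
  by rewrite -mulrDl -mulrDl divff // mul1r.
by rewrite lerD // chord ?lerDl ?lerDr.
Qed.

Theorem corollary2p1 (R : realType) (f : R -> R) (a b t : R)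
  (hf : radical_convex 2 f) (ha : 0 <= a) (hb : 0 <= b)
  (ht0 : 0 <= t) (ht1 : t <= 1) :
  f ((1 - t) * a + t * b) + f (Num.sqrt (t * (1 - t)) * `|a - b|)
    <= (1 - t) * f a + t * f b.
Proof.
case: hf => _ _ f0; set g := (X in convex_function _ X) => hg.
(* Lets every value of [f] in the goal be read as a value of [g] at a square. *)
have gsq (x : R) : 0 <= x -> g (x ^+ 2) = f x.
  by move=> x0; rewrite /g powR12_sqrt ?sqr_ge0 // sqrtr_sqr ger0_norm.
have g0 : g 0 <= 0 by rewrite -[X in g X](expr0n R 2) gsq // f0.
have t1 : 0 <= 1 - t by rewrite subr_ge0.
have m0 : 0 <= (1 - t) * a + t * b by rewrite addr_ge0 ?mulr_ge0.
have d0 : 0 <= Num.sqrt (t * (1 - t)) * `|a - b|.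
  by rewrite mulr_ge0 ?sqrtr_ge0.
rewrite -(gsq _ m0) -(gsq _ d0) -(gsq _ ha) -(gsq _ hb).
apply: (le_trans (@convex_function_superadditive _ g hg _ _ g0
  (sqr_ge0 _) (sqr_ge0 _))).
(* The [b] term comes first so that the weight [t] can serve as [s] in
   [convex_function_nonneg_le]. *)
have -> : ((1 - t) * a + t * b) ^+ 2 + (Num.sqrt (t * (1 - t)) * `|a - b|) ^+ 2
    = t * b ^+ 2 + (1 - t) * a ^+ 2.
  rewrite exprMn sqr_sqrtr ?mulr_ge0 // real_normK ?num_real //.
  by ring.
rewrite [leRHS]addrC.
exact: (@convex_function_nonneg_le R g hg _ _ _ (sqr_ge0 _) (sqr_ge0 _) ht0 ht1).
Qed.
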